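(* For a finite sequence $z_1,z_2,\dots,z_n$ in $\mathbb{D}$ (with $n\ge 1$) and $\gamma\in\mathbb{T}$, let $$B(z)=\gamma\prod_{i=1}^{n}\frac{z-z_i}{1-\overline{z_i}\,z}$$ be a finite Blaschke product. Then $B\in\mathscr{A}(\mathbb{D})$ is a singular element of $\mathscr{A}(\mathbb{D})$ but not a topological divisor of zero in $\mathscr{A}(\mathbb{D})$.
   Context: Let $\mathbb{D}=\{z\in\mathbb{C}:|z|<1\}$, let $\bar{\mathbb{D}}$ be its closure, and let $\mathbb{T}=\{z\in\mathbb{C}:|z|=1\}$. The disk algebra $\mathscr{A}(\mathbb{D})$ is the Banach algebra, under pointwise operations and the supremum norm, of all complex-valued functions continuous on $\bar{\mathbb{D}}$ and analytic in $\mathbb{D}$. An element $x$ of a Banach algebra $\mathcal{A}$ with identity is regular if there exists $y\in\mathcal{A}$ such that $xy=yx=1$, and singular if it is not regular. An element $z\in\mathcal{A}$ is called a topological divisor of zero if there exists a sequence $(z_n)_{n=1}^\infty$ in $\mathcal{A}$ such that $\|z_n\|=1$ for all $n\in\mathbb{N}$, and either $zz_n\to 0$ or $z_nz\to 0$ as $n\to\infty$. *)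

(* Defs.v *)
(* Stdlib reals, with Coquelicot's complex numbers [C]. *)
From Stdlib Require Import Reals Lra List.
From Stdlib Require Import FunctionalExtensionality ProofIrrelevance ClassicalEpsilon.
From Coquelicot Require Import Coquelicot.
Open Scope R_scope.

(* [AbsRing] is Coquelicot's structure of rings with identity carrying a
   submultiplicative norm [abs], with [abs (- 1) = 1].  The notions below involve
   only the multiplication and the norm of a Banach algebra, so they are stated
   at that level. *)

Definition regular {A : AbsRing} (x : A) : Prop :=
  exists y : A, mult x y = one /\ mult y x = one.

Definition singular {A : AbsRing} (x : A) : Prop := ~ regular x.

Definition topological_divisor_of_zero {A : AbsRing} (z : A) : Prop :=
  exists u : nat -> A,
    (forall n, abs (u n) = 1) /\
    (filterlim (fun n => mult z (u n)) eventually (locally (zero : A)) \/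
     filterlim (fun n => mult (u n) z) eventually (locally (zero : A))).

Definition closed_disk : Type := {z : C | Cmod z <= 1}.

(* Extension by 0 outside the closed disk.  It only serves to apply Coquelicot's
   [continuous_on] and [ex_derive], which expect total functions on [C]; neither
   condition of [in_disk_algebra] depends on the values outside the closed disk. *)
Definition extend (f : closed_disk -> C) (z : C) : C :=
  match Rle_dec (Cmod z) 1 with
  | left h => f (exist _ z h)
  | right _ => 0%C
  end.

(* [ex_derive] is taken over the field [C], so it is complex differentiability. *)
Definition in_disk_algebra (f : closed_disk -> C) : Prop :=
  continuous_on (fun z : C => Cmod z <= 1) (extend f) /\
  forall z : C, Cmod z < 1 -> ex_derive (extend f) z.

Definition disk_algebra : Type := {f : closed_disk -> C | in_disk_algebra f}.

(* [real] sends infinite values to 0; by [in_disk_algebra_bounded] below, this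
   never happens for elements of the disk algebra. *)
Definition sup_norm (f : closed_disk -> C) : R :=
  real (Lub_Rbar (fun r => exists z : closed_disk, r = Cmod (f z))).

Definition blaschke (gamma : C) (zs : list C) (z : C) : C :=
  (gamma * fold_right Cmult 1 (map (fun a => (z - a) / (1 - Cconj a * z)) zs))%C.

Lemma extend_in (f : closed_disk -> C) (z : C) (h : Cmod z <= 1) :
  extend f z = f (exist _ z h).
Proof.
unfold extend; destruct (Rle_dec (Cmod z) 1) as [h'|h'].
- now rewrite (proof_irrelevance _ h' h).
- easy.
Qed.

Lemma extend_out (f : closed_disk -> C) (z : C) :
  ~ Cmod z <= 1 -> extend f z = 0%C.
Proof. unfold extend; destruct (Rle_dec (Cmod z) 1); easy. Qed.

Lemma extend_plus (f g : closed_disk -> C) :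
  extend (fun z => f z + g z)%C = (fun z => extend f z + extend g z)%C.
Proof.
apply functional_extensionality; intros z; unfold extend.
destruct (Rle_dec (Cmod z) 1); [easy | ring].
Qed.

Lemma extend_opp (f : closed_disk -> C) :
  extend (fun z => - f z)%C = (fun z => - extend f z)%C.
Proof.
apply functional_extensionality; intros z; unfold extend.
destruct (Rle_dec (Cmod z) 1); [easy | ring].
Qed.

Lemma extend_mult (f g : closed_disk -> C) :
  extend (fun z => f z * g z)%C = (fun z => extend f z * extend g z)%C.
Proof.
apply functional_extensionality; intros z; unfold extend.
destruct (Rle_dec (Cmod z) 1); [easy | ring].
Qed.

(* On [C], Coquelicot has two normed module structures, with the same norm. *)
Lemma ex_derive_C_AbsRing (f : C -> C) (z : C) :
  @ex_derive C_AbsRing C_NormedModule f z <->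
  @ex_derive C_AbsRing (AbsRing_NormedModule C_AbsRing) f z.
Proof.
split; intros [l [[h1 h2 h3] h]]; exists l; (split; [split; assumption | exact h]).
Qed.

Lemma locally_C_le (x : C) :
  filter_le (@locally C_UniformSpace x) (@locally (AbsRing_UniformSpace C_AbsRing) x)
  /\ filter_le (@locally (AbsRing_UniformSpace C_AbsRing) x) (@locally C_UniformSpace x).
Proof. split; intros P; apply locally_C. Qed.

Lemma filterlim_C_mult {T : Type} (F : (T -> Prop) -> Prop) {FF : Filter F}
    (f g : T -> C) (a b : C) :
  filterlim f F (@locally C_UniformSpace a) ->
  filterlim g F (@locally C_UniformSpace b) ->
  filterlim (fun t => f t * g t)%C F (@locally C_UniformSpace (a * b)%C).
Proof.
intros Hf Hg.
apply filterlim_filter_le_2 with (1 := proj2 (locally_C_le _)).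
apply (filterlim_comp_2 f g (fun x y : C => (x * y)%C)
  (G := @locally (AbsRing_UniformSpace C_AbsRing) a)
  (H := @locally (AbsRing_UniformSpace C_AbsRing) b)).
- now apply filterlim_filter_le_2 with (1 := proj1 (locally_C_le _)).
- now apply filterlim_filter_le_2 with (1 := proj1 (locally_C_le _)).
- exact (@filterlim_mult C_AbsRing a b).
Qed.

Lemma in_disk_algebra_plus (f g : closed_disk -> C) :
  in_disk_algebra f -> in_disk_algebra g ->
  in_disk_algebra (fun z => f z + g z)%C.
Proof.
intros [Hfc Hfd] [Hgc Hgd]; unfold in_disk_algebra; rewrite extend_plus; split.
- intros z Hz.
  eapply filterlim_comp_2; [exact (Hfc z Hz) | exact (Hgc z Hz) |].
  exact (@filterlim_plus C_AbsRing C_NormedModule (extend f z) (extend g z)).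
- intros z Hz.
  exact (@ex_derive_plus C_AbsRing C_NormedModule _ _ z (Hfd z Hz) (Hgd z Hz)).
Qed.

Lemma in_disk_algebra_opp (f : closed_disk -> C) :
  in_disk_algebra f -> in_disk_algebra (fun z => - f z)%C.
Proof.
intros [Hfc Hfd]; unfold in_disk_algebra; rewrite extend_opp; split.
- intros z Hz.
  eapply filterlim_comp; [exact (Hfc z Hz) |].
  exact (@filterlim_opp C_AbsRing C_NormedModule (extend f z)).
- intros z Hz.
  exact (@ex_derive_opp C_AbsRing C_NormedModule _ z (Hfd z Hz)).
Qed.

Lemma in_disk_algebra_mult (f g : closed_disk -> C) :
  in_disk_algebra f -> in_disk_algebra g ->
  in_disk_algebra (fun z => f z * g z)%C.
Proof.
intros [Hfc Hfd] [Hgc Hgd]; unfold in_disk_algebra; rewrite extend_mult; split.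
- intros z Hz.
  apply filterlim_C_mult; [apply within_filter, locally_filter | |].
  + exact (Hfc z Hz).
  + exact (Hgc z Hz).
- intros z Hz.
  destruct (proj1 (ex_derive_C_AbsRing _ _) (Hfd z Hz)) as [a Ha].
  destruct (proj1 (ex_derive_C_AbsRing _ _) (Hgd z Hz)) as [b Hb].
  apply ex_derive_C_AbsRing; eexists.
  exact (@is_derive_mult C_AbsRing _ _ z a b Ha Hb Cmult_comm).
Qed.

Lemma in_disk_algebra_const (c : C) : in_disk_algebra (fun _ => c).
Proof.
split.
- intros z Hz P HP.
  rewrite (extend_in _ z Hz) in HP.
  unfold filtermap, within; apply filter_forall; intros w Hw.
  rewrite (extend_in _ w Hw); exact (locally_singleton _ _ HP).
- intros z Hz.
  apply (ex_derive_ext_loc (fun _ : C => c)).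
  + assert (He : 0 < 1 - Cmod z) by lra.
    exists (mkposreal _ He); intros w Hw.
    assert (Hw' : Cmod w <= 1).
    { change (Cmod (w - z) < 1 - Cmod z) in Hw.
      replace w with ((w - z) + z)%C by ring.
      pose proof (Cmod_triangle (w - z) z); lra. }
    now rewrite (extend_in _ w Hw').
  + exact (@ex_derive_const C_AbsRing C_NormedModule c z).
Qed.

Lemma in_disk_algebra_bounded (f : closed_disk -> C) :
  in_disk_algebra f -> exists M, forall z, Cmod (f z) <= M.
Proof.
intros [Hc _].
assert (Hd : forall z : C, exists d : posreal,
  d <= / (1 + Cmod (extend f z)) /\
  forall w : C, Cmod w <= 1 -> Rabs (fst w - fst z) < d -> Rabs (snd w - snd z) < d ->
    Cmod (extend f w) <= Cmod (extend f z) + 1).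
{ intros z.
  assert (H0 : 0 < / (1 + Cmod (extend f z))).
  { apply Rinv_0_lt_compat; pose proof (Cmod_ge_0 (extend f z)); lra. }
  destruct (classic (Cmod z <= 1)) as [Hz|Hz].
  - destruct (Hc z Hz (fun y => Cmod (y - extend f z) < 1)) as [e He].
    { apply locally_C; exists (mkposreal 1 Rlt_0_1); intros y Hy; exact Hy. }
    assert (Hm : 0 < Rmin e (/ (1 + Cmod (extend f z)))).
    { apply Rmin_pos; [apply cond_pos | exact H0]. }
    exists (mkposreal _ Hm); simpl; split; [apply Rmin_r |].
    intros w Hw H1 H2.
    assert (H3 : Cmod (extend f w - extend f z) < 1).
    { apply He; [| exact Hw]; split.
      - apply Rlt_le_trans with (1 := H1), Rmin_l.
      - apply Rlt_le_trans with (1 := H2), Rmin_l. }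
    replace (extend f w) with ((extend f w - extend f z) + extend f z)%C by ring.
    pose proof (Cmod_triangle (extend f w - extend f z) (extend f z)); lra.
  - assert (Hn : 1 < Cmod z) by lra.
    assert (Hm : 0 < Rmin ((Cmod z - 1) / 2) (/ (1 + Cmod (extend f z)))).
    { apply Rmin_pos; [lra | exact H0]. }
    exists (mkposreal _ Hm); simpl; split; [apply Rmin_r |].
    intros w Hw H1 H2; exfalso.
    assert (H3 := Rmin_l ((Cmod z - 1) / 2) (/ (1 + Cmod (extend f z)))).
    assert (H4 : Cmod z <= Cmod w + Cmod (z - w)).
    { replace z with (w + (z - w))%C at 1 by ring; apply Cmod_triangle. }
    assert (H5 : Cmod (z - w) < Cmod z - 1).
    { apply Rle_lt_trans with (1 := Cmod_2Rmax (z - w)).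
      assert (Hs : sqrt 2 < 2).
      { rewrite <- (sqrt_square 2) at 2 by lra; apply sqrt_lt_1; lra. }
      assert (Hp : 0 < sqrt 2) by (apply sqrt_lt_R0; lra).
      assert (H6 : Rmax (Rabs (fst (z - w)%C)) (Rabs (snd (z - w)%C)) < (Cmod z - 1) / 2).
      { change (fst (z - w)%C) with (fst z - fst w).
        change (snd (z - w)%C) with (snd z - snd w).
        rewrite (Rabs_minus_sym (fst z)), (Rabs_minus_sym (snd z)).
        apply Rmax_lub_lt; lra. }
      assert (0 <= Rmax (Rabs (fst (z - w)%C)) (Rabs (snd (z - w)%C))).
      { apply Rle_trans with (2 := Rmax_l _ _), Rabs_pos. }
      nra. }
    lra. }
pose (delta z := proj1_sig (constructive_indefinite_description _ (Hd z))).
assert (Hdelta := fun z => proj2_sig (constructive_indefinite_description _ (Hd z))).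
change (forall z, delta z <= / (1 + Cmod (extend f z)) /\
  forall w : C, Cmod w <= 1 ->
    Rabs (fst w - fst z) < delta z -> Rabs (snd w - snd z) < delta z ->
    Cmod (extend f w) <= Cmod (extend f z) + 1) in Hdelta.
clearbody delta.
destruct (compactness_value_2d (-1) 1 (-1) 1 (fun x y => delta (x, y))) as [d H].
exists (/ d); intros [z Hz].
rewrite <- (extend_in f z Hz).
assert (Hz1 : Rabs (fst z) <= 1 /\ Rabs (snd z) <= 1).
{ pose proof (Rmax_Cmod z).
  pose proof (Rmax_l (Rabs (fst z)) (Rabs (snd z))).
  pose proof (Rmax_r (Rabs (fst z)) (Rabs (snd z))). lra. }
apply NNPP; intros Hn.
apply (H (fst z) (snd z)).
- now apply Rabs_le_between.
- now apply Rabs_le_between.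
- intros (u & v & _ & _ & H1 & H2 & H3); apply Hn.
  destruct (Hdelta (u, v)) as [H4 H5].
  apply Rle_trans with (1 := H5 z Hz H1 H2).
  rewrite Rplus_comm, <- (Rinv_inv (1 + _)).
  apply Rinv_le_contravar; [apply cond_pos |].
  exact (Rle_trans _ _ _ H3 H4).
Qed.

Lemma sup_norm_is_lub (f : closed_disk -> C) (M : R) :
  (forall z, Cmod (f z) <= M) ->
  is_lub_Rbar (fun r => exists z : closed_disk, r = Cmod (f z)) (sup_norm f).
Proof.
intros HM; unfold sup_norm.
destruct (Lub_Rbar_correct (fun r => exists z : closed_disk, r = Cmod (f z)))
  as [Hub Hlub].
assert (h0 : Cmod (RtoC 0) <= 1) by (rewrite Cmod_0; lra).
assert (H1 : Rbar_le (Cmod (f (exist _ (RtoC 0) h0)))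
  (Lub_Rbar (fun r => exists z : closed_disk, r = Cmod (f z)))).
{ apply Hub; now exists (exist _ (RtoC 0) h0). }
assert (H2 := Hlub (Finite M)).
destruct (Lub_Rbar (fun r => exists z : closed_disk, r = Cmod (f z))) as [l| |]; simpl.
- split; assumption.
- exfalso; apply H2; intros r [z ->]; exact (HM z).
- contradiction.
Qed.

Lemma sup_norm_ge (f : closed_disk -> C) (z : closed_disk) :
  in_disk_algebra f -> Cmod (f z) <= sup_norm f.
Proof.
intros Hf; destruct (in_disk_algebra_bounded f Hf) as [M HM].
apply (proj1 (sup_norm_is_lub f M HM)); now exists z.
Qed.

Lemma sup_norm_le (f : closed_disk -> C) (M : R) :
  (forall z, Cmod (f z) <= M) -> sup_norm f <= M.
Proof.
intros HM; apply (proj2 (sup_norm_is_lub f M HM) (Finite M)).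
intros r [z ->]; exact (HM z).
Qed.

Lemma sup_norm_const (c : C) : sup_norm (fun _ => c) = Cmod c.
Proof.
assert (h0 : Cmod (RtoC 0) <= 1) by (rewrite Cmod_0; lra).
apply Rle_antisym; [apply sup_norm_le; intros; lra |].
exact (sup_norm_ge (fun _ => c) (exist _ (RtoC 0) h0) (in_disk_algebra_const c)).
Qed.

Definition da_plus (f g : disk_algebra) : disk_algebra :=
  exist _ _ (in_disk_algebra_plus _ _ (proj2_sig f) (proj2_sig g)).

Definition da_opp (f : disk_algebra) : disk_algebra :=
  exist _ _ (in_disk_algebra_opp _ (proj2_sig f)).

Definition da_mult (f g : disk_algebra) : disk_algebra :=
  exist _ _ (in_disk_algebra_mult _ _ (proj2_sig f) (proj2_sig g)).

Definition da_const (c : C) : disk_algebra := exist _ _ (in_disk_algebra_const c).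

Definition da_norm (f : disk_algebra) : R := sup_norm (proj1_sig f).

Lemma da_ext (f g : disk_algebra) :
  (forall z, proj1_sig f z = proj1_sig g z) -> f = g.
Proof.
intros H; apply eq_sig_hprop; [intros; apply proof_irrelevance |].
now apply functional_extensionality.
Qed.

Definition da_AbelianMonoid_mixin : AbelianMonoid.mixin_of disk_algebra.
Proof.
refine (AbelianMonoid.Mixin _ da_plus (da_const 0) _ _ _);
  intros; apply da_ext; intros; simpl; ring.
Defined.

Definition da_AbelianMonoid : AbelianMonoid :=
  AbelianMonoid.Pack disk_algebra da_AbelianMonoid_mixin disk_algebra.

Definition da_AbelianGroup_mixin : AbelianGroup.mixin_of da_AbelianMonoid.
Proof.
refine (AbelianGroup.Mixin da_AbelianMonoid da_opp _).
intros; apply da_ext; intros; simpl; ring.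
Defined.

Definition da_AbelianGroup : AbelianGroup :=
  AbelianGroup.Pack disk_algebra
    (AbelianGroup.Class _ da_AbelianMonoid_mixin da_AbelianGroup_mixin) disk_algebra.

Definition da_Ring_mixin : Ring.mixin_of da_AbelianGroup.
Proof.
refine (Ring.Mixin da_AbelianGroup da_mult (da_const 1) _ _ _ _ _);
  intros; apply da_ext; intros; simpl; ring.
Defined.

Definition da_Ring : Ring :=
  Ring.Pack disk_algebra
    (Ring.Class _ (AbelianGroup.class da_AbelianGroup) da_Ring_mixin) disk_algebra.

Definition da_AbsRing_mixin : AbsRing.mixin_of da_Ring.
Proof.
refine (AbsRing.Mixin da_Ring da_norm _ _ _ _ _).
- exact (eq_trans (sup_norm_const 0) Cmod_0).
- change (sup_norm (fun _ => - (1))%C = 1).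
  now rewrite sup_norm_const, Cmod_m1.
- intros f g; apply sup_norm_le; intros z; simpl.
  apply Rle_trans with (1 := Cmod_triangle _ _).
  apply Rplus_le_compat; apply sup_norm_ge, proj2_sig.
- intros f g; apply sup_norm_le; intros z; simpl.
  rewrite Cmod_mult.
  apply Rmult_le_compat; try apply Cmod_ge_0; apply sup_norm_ge, proj2_sig.
- intros f Hf; apply da_ext; intros z; simpl.
  apply Cmod_eq_0, Rle_antisym; [| apply Cmod_ge_0].
  rewrite <- Hf; apply sup_norm_ge, proj2_sig.
Defined.

Definition da_AbsRing : AbsRing :=
  AbsRing.Pack disk_algebra
    (AbsRing.Class _ (Ring.class da_Ring) da_AbsRing_mixin) disk_algebra.

Canonical da_AbelianMonoid.
Canonical da_AbelianGroup.
Canonical da_Ring.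
Canonical da_AbsRing.

(* Main.v *)
Require Import Defs.
From Stdlib Require Import Reals List.
From Coquelicot Require Import Coquelicot.
From Stdlib Require Import Lra Lia ClassicalEpsilon.
Open Scope R_scope.

(** A Blaschke product vanishes at each of its zeros, so it has no inverse.  It
    has modulus 1 on the unit circle, so by the maximum modulus principle
    multiplication by it does not decrease the norm of the disk algebra
    ([sup_norm_blaschke_mult_ge]); a sequence of unit vectors therefore cannot be
    sent to 0.

    Most of the work is the maximum modulus principle for functions of which only
    complex differentiability is known.  It is proved in the form
    [maximum_modulus]: a bound near the unit circle, on an annulus
    [r <= |z| < 1], holds in the whole open disk.  The route is as follows.

    - Goursat's theorem on rectangles ([rectangle_integral_zero]): the integral
      over the boundary of a rectangle is additive under subdivision, and on a
      small rectangle around a point it is negligible compared with the square of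
      its size, since the function is almost affine there.  The subdivision
      argument is isolated in [rectangle_cousin].

    - Polar coordinates [z = exp w].  The image of the rectangle
      [[a, b] x [0, 2 PI]] is an annulus, and the two horizontal sides contribute
      the same integral by periodicity.  Goursat's theorem thus says that the mean
      over a circle centred at 0 does not depend on the radius
      ([circle_integral_constant]).  Letting the radius tend to 0 gives the bound
      at the centre ([Cmod_center_le]).

    - A Moebius transformation moves the centre to any other point of the disk
      and maps circles close to the unit circle to curves close to it.

    The same estimate of a Moebius transformation near the unit circle
    ([Cmod_mobius_ge]) shows that the modulus of a Blaschke product is close to 1
    on a thin annulus.  Working on annuli instead of the circle means that
    boundary values need no limiting argument. *)

(** * Complex differentiability in epsilon-delta form *)

Lemma Cmod_le_split (x y : R) : Cmod (x, y) <= Rabs x + Rabs y.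
Proof.
replace ((x, y) : C) with (RtoC x + RtoC y * Ci)%C
  by (apply injective_projections; simpl; ring).
apply Rle_trans with (1 := Cmod_triangle _ _).
rewrite Cmod_mult, !Cmod_R, Cmod_Ci; lra.
Qed.

(** All limits below are estimated by hand in terms of [Cmod], which avoids the
    several uniform structures that coexist on [C]. *)
Lemma is_derive_C_eps (f : C -> C) (z l : C) :
  is_derive f z l <->
  forall eps : R, 0 < eps -> exists delta : R, 0 < delta /\
    forall w : C, Cmod (w - z) < delta ->
      Cmod (f w - f z - (w - z) * l) <= eps * Cmod (w - z).
Proof.
split.
- intros [_ H] eps Heps.
  destruct (H z (fun P HP => HP) (mkposreal eps Heps)) as [d Hd].
  exists d; split; [apply cond_pos |].
  intros w Hw; exact (Hd w Hw).
- intros H; split; [exact (is_linear_scal_l l) |].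
  intros x Hx eps.
  rewrite <- (@is_filter_lim_locally_unique C_AbsRing
  (AbsRing_NormedModule C_AbsRing) z x Hx).
  destruct (H eps (cond_pos eps)) as [d [Hd0 Hd]].
  exists (mkposreal d Hd0); intros w Hw; exact (Hd w Hw).
Qed.

Lemma ex_derive_C_continuous_eps (f : C -> C) (z : C) :
  ex_derive f z ->
  forall eps : R, 0 < eps -> exists delta : R, 0 < delta /\
    forall w : C, Cmod (w - z) < delta -> Cmod (f w - f z) < eps.
Proof.
intros [l Hl] eps Heps.
destruct (proj1 (is_derive_C_eps f z l) Hl 1 Rlt_0_1) as [d [Hd0 Hd]].
assert (Hl0 := Cmod_ge_0 l).
assert (He : 0 < eps / (1 + Cmod l)) by (apply Rdiv_lt_0_compat; lra).
exists (Rmin d (eps / (1 + Cmod l))); split; [now apply Rmin_pos |].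
intros w Hw.
assert (H1 := Hd w (Rlt_le_trans _ _ _ Hw (Rmin_l _ _))).
assert (H2 := Rlt_le_trans _ _ _ Hw (Rmin_r _ _)).
apply Rlt_div_r in H2; [| lra].
replace (f w - f z)%C with ((f w - f z - (w - z) * l) + (w - z) * l)%C by ring.
apply Rle_lt_trans with (1 := Cmod_triangle _ _).
rewrite Cmod_mult; lra.
Qed.

Lemma ex_derive_C_comp (f g : C -> C) (z : C) :
  ex_derive f (g z) -> ex_derive g z -> ex_derive (fun w => f (g w)) z.
Proof.
intros [a Ha] Hg.
apply ex_derive_C_AbsRing in Hg; destruct Hg as [b Hb].
eexists; exact (is_derive_comp f g z a b Ha Hb).
Qed.

Lemma ex_derive_C_mult (f g : C -> C) (z : C) :
  ex_derive f z -> ex_derive g z -> ex_derive (fun w => f w * g w)%C z.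
Proof.
intros Hf Hg.
apply ex_derive_C_AbsRing in Hf; destruct Hf as [a Ha].
apply ex_derive_C_AbsRing in Hg; destruct Hg as [b Hb].
apply ex_derive_C_AbsRing; eexists.
exact (@is_derive_mult C_AbsRing _ _ z a b Ha Hb Cmult_comm).
Qed.

Lemma ex_derive_C_affine (u v z : C) : ex_derive (fun w => u + v * w)%C z.
Proof.
exists v; apply is_derive_C_eps; intros eps Heps; exists 1; split; [lra |].
intros w _.
replace (u + v * w - (u + v * z) - (w - z) * v)%C with (RtoC 0) by ring.
rewrite Cmod_0; assert (H := Cmod_ge_0 (w - z)); nra.
Qed.

Lemma ex_derive_Cinv (z : C) : z <> 0%C -> ex_derive Cinv z.
Proof.
intros Hz; exists (- / (z * z))%C; apply is_derive_C_eps; intros eps Heps.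
assert (Hz0 : 0 < Cmod z) by now apply Cmod_gt_0.
assert (Hz3 : 0 < Cmod z ^ 3) by now apply pow_lt.
exists (Rmin (Cmod z / 2) (eps * Cmod z ^ 3 / 2)); split.
{ apply Rmin_pos; [lra |]. assert (H := Rmult_lt_0_compat _ _ Heps Hz3); lra. }
intros w Hw.
assert (H1 := Rlt_le_trans _ _ _ Hw (Rmin_l _ _)).
assert (H2 := Rlt_le_trans _ _ _ Hw (Rmin_r _ _)).
assert (Hw2 : Cmod z / 2 <= Cmod w).
{ assert (H := Cmod_triangle w (z - w)).
  replace (w + (z - w))%C with z in H by ring.
  replace (z - w)%C with (- (w - z))%C in H by ring.
  rewrite Cmod_opp in H; lra. }
assert (Hw0 : w <> 0%C) by (apply Cmod_gt_0; lra).
(* The error of the linear approximation is quadratic in [w - z]. *)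
replace (/ w - / z - (w - z) * - / (z * z))%C
  with ((w - z) * (w - z) * / (w * (z * z)))%C by (field; now split).
rewrite !Cmod_mult, Cmod_inv, !Cmod_mult by (repeat apply Cmult_neq_0; assumption).
assert (Hd := Cmod_ge_0 (w - z)).
set (d := Cmod (w - z)) in *; set (a := Cmod z) in *; set (b := Cmod w) in *.
assert (Hp : 0 < b * (a * a)) by (repeat apply Rmult_lt_0_compat; lra).
apply Rle_div_l; [exact Hp |].
assert (H3 : d <= eps * (b * (a * a))).
{ apply Rle_trans with (eps * (a / 2 * (a * a))); [simpl in H2; lra |].
  apply Rmult_le_compat_l; [lra |].
  apply Rmult_le_compat_r; nra. }
nra.
Qed.

(** * Subdivision of rectangles and Goursat's theorem *)

(** Cousin's lemma for the rectangles similar to a given one, [Q x y t] being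
    about the rectangle with lower left corner [(x, y)] and sides [t * w], [t * h].
    If [Q] failed for the whole rectangle, it would fail for one of its quarters,
    for a quarter of that one, and so on; these nested rectangles shrink to a
    point, near which [Q] holds.  Keeping the proportions fixed makes [t ^ 2] an
    exact measure of area, which is what Goursat's argument needs; so does the
    requirement that the small rectangles contain the point. *)
Lemma rectangle_cousin (Q : R -> R -> R -> Prop) (x0 y0 w h : R) :
  0 <= w -> 0 <= h ->
  (forall x y t, 0 < t ->
     Q x y (t / 2) -> Q (x + t / 2 * w) y (t / 2) ->
     Q x (y + t / 2 * h) (t / 2) -> Q (x + t / 2 * w) (y + t / 2 * h) (t / 2) ->
     Q x y t) ->
  (forall p q, x0 <= p <= x0 + w -> y0 <= q <= y0 + h ->
     exists delta, 0 < delta /\ forall x y t, 0 < t < delta ->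
       x <= p <= x + t * w -> y <= q <= y + t * h -> Q x y t) ->
  Q x0 y0 1.
Proof.
intros Hw Hh Hquarter Hlocal; apply NNPP; intros Hbad.
assert (Hstep : forall (n : nat) (p : R * R), exists p' : R * R,
  ~ Q (fst p) (snd p) ((/ 2) ^ n) ->
  ~ Q (fst p') (snd p') ((/ 2) ^ S n) /\
  fst p <= fst p' <= fst p + (/ 2) ^ S n * w /\
  snd p <= snd p' <= snd p + (/ 2) ^ S n * h).
{ intros n [x y]; simpl.
  assert (Ht : 0 < (/ 2) ^ n) by (apply pow_lt; lra).
  replace (/ 2 * (/ 2) ^ n) with ((/ 2) ^ n / 2) by lra.
  set (t := (/ 2) ^ n) in *; clearbody t.
  assert (0 <= t / 2 * w) by nra.
  assert (0 <= t / 2 * h) by nra.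
  destruct (classic (Q x y (t / 2))) as [H1|H1];
    [| exists (x, y); simpl; repeat split; auto; lra].
  destruct (classic (Q (x + t / 2 * w) y (t / 2))) as [H2|H2];
    [| exists (x + t / 2 * w, y); simpl; repeat split; auto; lra].
  destruct (classic (Q x (y + t / 2 * h) (t / 2))) as [H3|H3];
    [| exists (x, y + t / 2 * h); simpl; repeat split; auto; lra].
  destruct (classic (Q (x + t / 2 * w) (y + t / 2 * h) (t / 2))) as [H4|H4];
    [| exists (x + t / 2 * w, y + t / 2 * h); simpl; repeat split; auto; lra].
  exists (x, y); intros Hn; destruct Hn; now apply Hquarter. }
pose (next n p := proj1_sig (constructive_indefinite_description _ (Hstep n p))).
assert (Hnext := fun n p =>
  proj2_sig (constructive_indefinite_description _ (Hstep n p))).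
change (forall n p, ~ Q (fst p) (snd p) ((/ 2) ^ n) ->
  ~ Q (fst (next n p)) (snd (next n p)) ((/ 2) ^ S n) /\
  fst p <= fst (next n p) <= fst p + (/ 2) ^ S n * w /\
  snd p <= snd (next n p) <= snd p + (/ 2) ^ S n * h) in Hnext.
clearbody next.
pose (s := fix s n := match n with O => (x0, y0) | S n => next n (s n) end).
assert (Hs : forall n, ~ Q (fst (s n)) (snd (s n)) ((/ 2) ^ n)).
{ induction n as [|n IH]; [exact Hbad |]. exact (proj1 (Hnext n (s n) IH)). }
assert (Hs1 := fun n => proj2 (Hnext n (s n) (Hs n))).
change (forall n, fst (s n) <= fst (s (S n)) <= fst (s n) + (/ 2) ^ S n * w /\
  snd (s n) <= snd (s (S n)) <= snd (s n) + (/ 2) ^ S n * h) in Hs1.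
(* Nested intervals whose lengths tend to 0 have a common point. *)
assert (Hnested : forall (u : nat -> R) (c : R), 0 <= c ->
  (forall n, u n <= u (S n) <= u n + (/ 2) ^ S n * c) ->
  exists p, forall n, u n <= p <= u n + (/ 2) ^ n * c).
{ intros u c Hc Hu.
  assert (Hpow : forall n, 0 < (/ 2) ^ n) by (intros; apply pow_lt; lra).
  assert (Hinc : forall n k, u n <= u (n + k)%nat).
  { intros n; induction k as [|k IH]; [rewrite Nat.add_0_r; lra |].
    rewrite Nat.add_succ_r; apply Rle_trans with (1 := IH), Hu. }
  assert (Hdec : forall n k,
    u (n + k)%nat + (/ 2) ^ (n + k) * c <= u n + (/ 2) ^ n * c).
  { intros n; induction k as [|k IH]; [rewrite Nat.add_0_r; lra |].
    rewrite Nat.add_succ_r; apply Rle_trans with (2 := IH).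
    specialize (Hu (n + k)%nat); simpl in Hu |- *.
    set (t := (/ 2) ^ (n + k)) in *; lra. }
  assert (Hall : forall n m, u m <= u n + (/ 2) ^ n * c).
  { intros n m; apply Rle_trans with (u (n + m)%nat).
    - rewrite Nat.add_comm; apply Hinc.
    - assert (H := Hdec n m); specialize (Hpow (n + m)%nat); nra. }
  destruct (completeness (fun r => exists n, r = u n)) as [p [Hp1 Hp2]].
  - exists (u O + (/ 2) ^ 0 * c); intros r [n ->]; apply Hall.
  - exists (u O); now exists O.
  - exists p; intros n; split.
    + apply Hp1; now exists n.
    + apply Hp2; intros r [m ->]; apply Hall. }
destruct (Hnested _ w Hw (fun n => proj1 (Hs1 n))) as [p Hp].
destruct (Hnested _ h Hh (fun n => proj2 (Hs1 n))) as [q Hq].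
destruct (Hlocal p q) as [d [Hd0 Hd]].
{ specialize (Hp O); simpl in Hp; lra. }
{ specialize (Hq O); simpl in Hq; lra. }
destruct (pow_lt_1_zero (/ 2)) with (y := d) as [n Hn];
  [rewrite Rabs_pos_eq; lra | exact Hd0 |].
specialize (Hn n (le_n n)).
assert (H2 : 0 < (/ 2) ^ n) by (apply pow_lt; lra).
rewrite Rabs_pos_eq in Hn by lra.
apply (Hs n), Hd; [lra | apply Hp | apply Hq].
Qed.

(** [C] carries a normed module structure over itself and one over [R]; paths are
    parametrized by reals, so the integral has to be taken in the latter. *)
Definition CInt (f : R -> C) (a b : R) : C := @RInt C_R_CompleteNormedModule f a b.
Definition is_CInt (f : R -> C) (a b : R) (l : C) : Prop :=
  @is_RInt C_R_NormedModule f a b l.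

(** The integral of [F z dz] along the positively oriented boundary of
    [[a, b] x [c, d]]. *)
Definition rectangle_integral (F : C -> C) (a b c d : R) : C :=
  (CInt (fun x => F (x, c)) a b + Ci * CInt (fun y => F (b, y)) c d
   - CInt (fun x => F (x, d)) a b - Ci * CInt (fun y => F (a, y)) c d)%C.

Lemma is_CInt_horizontal (F : C -> C) (a b c : R) :
  (forall x, a <= x <= b -> ex_derive F (x, c)) -> a <= b ->
  is_CInt (fun x => F (x, c)) a b (CInt (fun x => F (x, c)) a b).
Proof.
intros HF Hab; apply (@RInt_correct C_R_CompleteNormedModule),
  (@ex_RInt_continuous C_R_CompleteNormedModule).
rewrite Rmin_left, Rmax_right by exact Hab.
intros x Hx; apply filterlim_locally; intros eps.
destruct (ex_derive_C_continuous_eps F (x, c) (HF x Hx) eps (cond_pos eps))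
  as [d [Hd0 Hd]].
exists (mkposreal d Hd0); intros t Ht.
apply C_NormedModule_mixin_compat1, Hd.
apply Rle_lt_trans with (2 := Ht : Rabs (t - x) < d).
rewrite <- Cmod_R; apply Req_le, f_equal.
apply injective_projections; simpl; ring.
Qed.

Lemma is_CInt_vertical (F : C -> C) (a c d : R) :
  (forall y, c <= y <= d -> ex_derive F (a, y)) -> c <= d ->
  is_CInt (fun y => F (a, y)) c d (CInt (fun y => F (a, y)) c d).
Proof.
intros HF Hab; apply (@RInt_correct C_R_CompleteNormedModule),
  (@ex_RInt_continuous C_R_CompleteNormedModule).
rewrite Rmin_left, Rmax_right by exact Hab.
intros x Hx; apply filterlim_locally; intros eps.
destruct (ex_derive_C_continuous_eps F (a, x) (HF x Hx) eps (cond_pos eps))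
  as [e [He0 He]].
exists (mkposreal e He0); intros t Ht.
apply C_NormedModule_mixin_compat1, He.
apply Rle_lt_trans with (2 := Ht : Rabs (t - x) < e).
rewrite <- (Rmult_1_r (Rabs _)), <- Cmod_R, <- Cmod_Ci, <- Cmod_mult.
apply Req_le, f_equal, injective_projections; simpl; ring.
Qed.

Lemma is_CInt_affine (u v : C) (a b : R) :
  is_CInt (fun t => u + RtoC t * v)%C a b
    (RtoC (b - a) * u + RtoC ((b * b - a * a) / 2) * v)%C.
Proof.
assert (H : forall u v : R,
  is_RInt (fun t => u + t * v) a b ((b - a) * u + (b * b - a * a) / 2 * v)).
{ intros u' v'.
  replace ((b - a) * u' + (b * b - a * a) / 2 * v')
    with (minus (b * u' + b * b / 2 * v') (a * u' + a * a / 2 * v'))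
    by (unfold minus, plus, opp; simpl; field).
  apply (is_RInt_derive (fun t => t * u' + t * t / 2 * v')).
  - intros t _; auto_derive; [trivial | field].
  - intros t _; apply (ex_derive_continuous (fun t => u' + t * v')).
    auto_derive; trivial. }
replace (RtoC (b - a) * u + RtoC ((b * b - a * a) / 2) * v)%C
  with ((b - a) * fst u + (b * b - a * a) / 2 * fst v,
        (b - a) * snd u + (b * b - a * a) / 2 * snd v)
  by (apply injective_projections; simpl; ring).
apply (@is_RInt_fct_extend_pair R_NormedModule R_NormedModule).
- apply is_RInt_ext with (2 := H (fst u) (fst v)).
  intros t _; simpl; ring.
- apply is_RInt_ext with (2 := H (snd u) (snd v)).
  intros t _; simpl; ring.
Qed.

Lemma is_CInt_close (f g : R -> C) (a b M : R) (lf lg : C) :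
  a <= b -> is_CInt f a b lf -> is_CInt g a b lg ->
  (forall t, a <= t <= b -> Cmod (f t - g t) <= M) ->
  Cmod (lf - lg) <= (b - a) * M.
Proof.
intros Hab Hf Hg HM.
assert (H := is_RInt_minus _ _ _ _ _ _ Hf Hg).
rewrite Cmod_norm.
refine (norm_RInt_le_const _ a b _ M Hab _ H).
intros t Ht; specialize (HM t Ht); rewrite Cmod_norm in HM; exact HM.
Qed.

Lemma rectangle_integral_split_x (F : C -> C) (a m b c d : R) :
  a <= m <= b -> c <= d ->
  (forall x y, a <= x <= b -> c <= y <= d -> ex_derive F (x, y)) ->
  rectangle_integral F a b c d
  = (rectangle_integral F a m c d + rectangle_integral F m b c d)%C.
Proof.
intros Hm Hcd HF; unfold rectangle_integral.
assert (H : forall y, c <= y <= d -> CInt (fun x => F (x, y)) a b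
  = (CInt (fun x => F (x, y)) a m + CInt (fun x => F (x, y)) m b)%C).
{ intros y Hy; symmetry.
  apply (@RInt_Chasles C_R_CompleteNormedModule); eexists; apply is_CInt_horizontal;
    try lra; intros x Hx; apply HF; lra. }
rewrite (H c), (H d) by lra; ring.
Qed.

Lemma rectangle_integral_split_y (F : C -> C) (a b c m d : R) :
  a <= b -> c <= m <= d ->
  (forall x y, a <= x <= b -> c <= y <= d -> ex_derive F (x, y)) ->
  rectangle_integral F a b c d
  = (rectangle_integral F a b c m + rectangle_integral F a b m d)%C.
Proof.
intros Hab Hm HF; unfold rectangle_integral.
assert (H : forall x, a <= x <= b -> CInt (fun y => F (x, y)) c d
  = (CInt (fun y => F (x, y)) c m + CInt (fun y => F (x, y)) m d)%C).
{ intros x Hx; symmetry.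
  apply (@RInt_Chasles C_R_CompleteNormedModule); eexists; apply is_CInt_vertical;
    try lra; intros y Hy; apply HF; lra. }
rewrite (H a), (H b) by lra; ring.
Qed.

(** An affine function has a primitive, so its integral along the boundary is 0;
    only the error of the approximation contributes, at most [M] times the
    perimeter. *)
Lemma rectangle_integral_near_affine (F : C -> C) (a b c d M : R) (u v : C) :
  a <= b -> c <= d ->
  (forall x y, a <= x <= b -> c <= y <= d -> ex_derive F (x, y)) ->
  (forall x y, a <= x <= b -> c <= y <= d ->
     Cmod (F (x, y) - (u + v * (x, y))) <= M) ->
  Cmod (rectangle_integral F a b c d) <= 2 * ((b - a) + (d - c)) * M.
Proof.
intros Hab Hcd HF HM.
(* The integrals of the affine function along horizontal and vertical sides. *)
pose (Hor y := (RtoC (b - a) * (u + v * (RtoC y * Ci))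
  + RtoC ((b * b - a * a) / 2) * v)%C).
pose (Ver x := (RtoC (d - c) * (u + v * RtoC x)
  + RtoC ((d * d - c * c) / 2) * (v * Ci))%C).
assert (Hhor : forall y, c <= y <= d ->
  Cmod (CInt (fun x => F (x, y)) a b - Hor y) <= (b - a) * M).
{ intros y Hy.
  apply is_CInt_close with (2 := is_CInt_horizontal F a b y (fun x Hx => HF x y Hx Hy) Hab)
    (3 := is_CInt_affine _ _ a b); [exact Hab |].
  intros x Hx.
  replace (u + v * (RtoC y * Ci) + RtoC x * v)%C with (u + v * (x, y))%C
    by (apply injective_projections; simpl; ring).
  now apply HM. }
assert (Hver : forall x, a <= x <= b ->
  Cmod (CInt (fun y => F (x, y)) c d - Ver x) <= (d - c) * M).
{ intros x Hx.
  apply is_CInt_close with (2 := is_CInt_vertical F x c d (fun y Hy => HF x y Hx Hy) Hcd)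
    (3 := is_CInt_affine _ _ c d); [exact Hcd |].
  intros y Hy.
  replace (u + v * RtoC x + RtoC y * (v * Ci))%C with (u + v * (x, y))%C
    by (apply injective_projections; simpl; ring).
  now apply HM. }
assert (H0 : (Hor c + Ci * Ver b - Hor d - Ci * Ver a)%C = RtoC 0).
{ unfold Hor, Ver; apply injective_projections; simpl; field. }
unfold rectangle_integral.
assert (H1 := Hhor c ltac:(lra)); assert (H2 := Hhor d ltac:(lra)).
assert (H3 := Hver a ltac:(lra)); assert (H4 := Hver b ltac:(lra)).
set (I1 := CInt (fun x => F (x, c)) a b) in *.
set (I2 := CInt (fun x => F (x, d)) a b) in *.
set (I3 := CInt (fun y => F (a, y)) c d) in *.
set (I4 := CInt (fun y => F (b, y)) c d) in *.
replace (I1 + Ci * I4 - I2 - Ci * I3)%C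
  with ((I1 - Hor c) + Ci * (I4 - Ver b) + - (I2 - Hor d) + - (Ci * (I3 - Ver a))
        + (Hor c + Ci * Ver b - Hor d - Ci * Ver a))%C by ring.
rewrite H0, Cplus_0_r.
eapply Rle_trans; [apply Cmod_triangle |].
eapply Rle_trans; [apply Rplus_le_compat_r, Cmod_triangle |].
eapply Rle_trans; [apply Rplus_le_compat_r, Rplus_le_compat_r, Cmod_triangle |].
rewrite !Cmod_opp, !Cmod_mult, Cmod_Ci; lra.
Qed.

(** Goursat's theorem.  No continuity of the derivative is assumed: for every
    [eps], [rectangle_cousin] bounds the integral over a rectangle of scale [t]
    by a multiple of [eps * t ^ 2], because near a point of differentiability the
    error of the affine approximation is at most [eps] times the diameter, and
    the perimeter is itself of order [t]. *)
Lemma rectangle_integral_zero (F : C -> C) (a b c d : R) :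
  a <= b -> c <= d ->
  (forall x y, a <= x <= b -> c <= y <= d -> ex_derive F (x, y)) ->
  rectangle_integral F a b c d = RtoC 0.
Proof.
intros Hab Hcd HF.
set (w := b - a); set (h := d - c).
assert (Hw : 0 <= w) by (unfold w; lra); assert (Hh : 0 <= h) by (unfold h; lra).
assert (Hsmall : forall eps, 0 < eps ->
  Cmod (rectangle_integral F a b c d) <= 2 * eps * (w + h) ^ 2).
{ intros eps Heps.
  pose (Q x y t := a <= x -> x + t * w <= b -> c <= y -> y + t * h <= d ->
    Cmod (rectangle_integral F x (x + t * w) y (y + t * h))
    <= 2 * eps * (w + h) ^ 2 * t ^ 2).
  assert (HQ : Q a c 1).
  2: { unfold Q in HQ.
    replace (a + 1 * w) with b in HQ by (unfold w; ring).
    replace (c + 1 * h) with d in HQ by (unfold h; ring).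
    rewrite pow1, Rmult_1_r in HQ; apply HQ; lra. }
  apply rectangle_cousin with (w := w) (h := h); try assumption.
  - intros x y t Ht Q1 Q2 Q3 Q4; unfold Q in *; clear Q.
    intros Hx1 Hx2 Hy1 Hy2.
    replace (x + t / 2 * w + t / 2 * w) with (x + t * w) in Q2, Q4 by field.
    replace (y + t / 2 * h + t / 2 * h) with (y + t * h) in Q3, Q4 by field.
    assert (0 <= t * w) by nra; assert (0 <= t * h) by nra.
    assert (HF' : forall x' y', x <= x' <= x + t * w -> y <= y' <= y + t * h ->
      ex_derive F (x', y')) by (intros; apply HF; lra).
    rewrite (rectangle_integral_split_x F _ (x + t / 2 * w)) by (try assumption; lra).
    rewrite (rectangle_integral_split_y F x _ y (y + t / 2 * h)),
      (rectangle_integral_split_y F (x + t / 2 * w) _ y (y + t / 2 * h))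
      by (try (intros; apply HF'); lra).
    specialize (Q1 ltac:(lra) ltac:(lra) ltac:(lra) ltac:(lra)).
    specialize (Q2 ltac:(lra) ltac:(lra) ltac:(lra) ltac:(lra)).
    specialize (Q3 ltac:(lra) ltac:(lra) ltac:(lra) ltac:(lra)).
    specialize (Q4 ltac:(lra) ltac:(lra) ltac:(lra) ltac:(lra)).
    replace (t ^ 2) with (4 * (t / 2) ^ 2) by field.
    eapply Rle_trans; [apply Cmod_triangle |].
    eapply Rle_trans; [apply Rplus_le_compat; apply Cmod_triangle |].
    lra.
  - intros p q Hp Hq.
    destruct (HF p q) as [l Hl]; [unfold w in Hp; lra | unfold h in Hq; lra |].
    destruct (proj1 (is_derive_C_eps F (p, q) l) Hl eps Heps) as [e [He0 He]].
    exists (e / (1 + w + h)); split; [apply Rdiv_lt_0_compat; lra |].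
    intros x y t [Ht0 Ht] Hxp Hyq Hx1 Hx2 Hy1 Hy2.
    apply Rlt_div_r in Ht; [| lra].
    replace (2 * eps * (w + h) ^ 2 * t ^ 2)
      with (2 * ((x + t * w - x) + (y + t * h - y)) * (eps * (t * (w + h)))) by ring.
    apply rectangle_integral_near_affine with (u := (F (p, q) - (p, q) * l)%C) (v := l);
      [nra | nra | intros; apply HF; lra |].
    intros x' y' Hx' Hy'.
    replace (F (x', y') - (F (p, q) - (p, q) * l + l * (x', y')))%C
      with (F (x', y') - F (p, q) - ((x', y') - (p, q)) * l)%C by ring.
    assert (Hdist : Cmod ((x', y') - (p, q))%C <= t * (w + h)).
    { apply Rle_trans with (1 := Cmod_le_split (x' + - p) (y' + - q)).
      assert (Rabs (x' + - p) <= t * w) by (apply Rabs_le; lra).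
      assert (Rabs (y' + - q) <= t * h) by (apply Rabs_le; lra).
      lra. }
    apply Rle_trans with (1 := He (x', y') ltac:(nra)).
    apply Rmult_le_compat_l; lra. }
apply Cmod_eq_0, Rle_antisym; [| apply Cmod_ge_0].
apply le_epsilon; intros eps Heps; rewrite Rplus_0_l.
(* The summand 1 keeps the divisor positive for a degenerate rectangle. *)
set (k := 2 * (w + h) ^ 2 + 1).
assert (Hk : 0 < k) by (unfold k; nra).
apply Rle_trans with (1 := Hsmall (eps / k) (Rdiv_lt_0_compat _ _ Heps Hk)).
replace (2 * (eps / k) * (w + h) ^ 2) with (eps * ((k - 1) / k)) by (unfold k; field; fold k; lra).
assert ((k - 1) / k <= 1) by (apply Rle_div_l; lra).
nra.
Qed.

(** * Mean values over circles *)

Definition cexp (w : C) : C := (exp (Re w) * cos (Im w), exp (Re w) * sin (Im w)).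

Lemma cexp_plus (v w : C) : cexp (v + w) = (cexp v * cexp w)%C.
Proof.
unfold cexp, Re, Im; apply injective_projections; simpl;
  rewrite exp_plus, ?cos_plus, ?sin_plus; ring.
Qed.

Lemma Cmod_cexp (w : C) : Cmod (cexp w) = exp (Re w).
Proof.
unfold cexp, Cmod; simpl.
apply sqrt_lem_1; [nra | apply Rlt_le, exp_pos |].
transitivity (exp (Re w) * exp (Re w) * (Rsqr (sin (Im w)) + Rsqr (cos (Im w))));
  [rewrite sin2_cos2 | unfold Rsqr]; ring.
Qed.

(** Multiplying out the difference quotient covers the case [h = 0] as well. *)
Lemma derivable_pt_lim_0_eps (f : R -> R) (l : R) :
  derivable_pt_lim f 0 l ->
  forall eps, 0 < eps -> exists delta, 0 < delta /\
    forall h, Rabs h < delta -> Rabs (f h - f 0 - h * l) <= eps * Rabs h.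
Proof.
intros Hf eps Heps; destruct (Hf eps Heps) as [d Hd].
exists d; split; [apply cond_pos |]; intros h Hh.
destruct (Req_dec h 0) as [->|Hh0].
- replace (f 0 - f 0 - 0 * l) with 0 by ring; rewrite Rabs_R0; lra.
- specialize (Hd h Hh0 Hh); rewrite Rplus_0_l in Hd.
  replace (f h - f 0 - h * l) with (((f h - f 0) / h - l) * h) by now field.
  rewrite Rabs_mult; apply Rmult_le_compat_r; [apply Rabs_pos | lra].
Qed.

(** By [cexp_plus] it suffices to estimate [cexp k - 1 - k] for small [k], which
    reduces to the derivatives of [exp], [sin] and [cos] at 0. *)
Lemma ex_derive_cexp (w : C) : ex_derive cexp w.
Proof.
assert (H0 : forall eps, 0 < eps -> exists delta, 0 < delta /\
  forall k, Cmod k < delta -> Cmod (cexp k - 1 - k) <= eps * Cmod k).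
{ intros eps Heps.
  (* 8 = 3 + 5 is the sum of the constants in the bounds [Hre] and [Him] of the
     real and imaginary parts. *)
  set (e := Rmin (eps / 8) 1).
  assert (He : 0 < e) by (apply Rmin_pos; lra).
  assert (He1 : e <= eps / 8) by apply Rmin_l.
  assert (He2 : e <= 1) by apply Rmin_r.
  clearbody e.
  destruct (derivable_pt_lim_0_eps exp 1) with (eps := e) as [d1 [Hd1 H1]];
    [exact derivable_pt_lim_exp_0 | exact He |].
  destruct (derivable_pt_lim_0_eps sin 1) with (eps := e) as [d2 [Hd2 H2]];
    [rewrite <- cos_0; apply derivable_pt_lim_sin | exact He |].
  destruct (derivable_pt_lim_0_eps cos 0) with (eps := e) as [d3 [Hd3 H3]];
    [replace 0 with (- sin 0) at 2 by (rewrite sin_0; ring);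
     apply derivable_pt_lim_cos | exact He |].
  exists (Rmin (Rmin d1 e) (Rmin d2 d3)); split; [repeat apply Rmin_pos; assumption |].
  intros [x y] Hk.
  assert (Hk1 := Rlt_le_trans _ _ _ Hk (Rle_trans _ _ _ (Rmin_l _ _) (Rmin_l _ _))).
  assert (Hk2 := Rlt_le_trans _ _ _ Hk (Rle_trans _ _ _ (Rmin_l _ _) (Rmin_r _ _))).
  assert (Hk3 := Rlt_le_trans _ _ _ Hk (Rle_trans _ _ _ (Rmin_r _ _) (Rmin_l _ _))).
  assert (Hk4 := Rlt_le_trans _ _ _ Hk (Rle_trans _ _ _ (Rmin_r _ _) (Rmin_r _ _))).
  assert (Hxy := Rmax_Cmod (x, y)); simpl in Hxy.
  assert (Hx : Rabs x <= Cmod (x, y)) by (apply Rle_trans with (2 := Hxy), Rmax_l).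
  assert (Hy : Rabs y <= Cmod (x, y)) by (apply Rle_trans with (2 := Hxy), Rmax_r).
  specialize (H1 x ltac:(lra)); specialize (H2 y ltac:(lra)); specialize (H3 y ltac:(lra)).
  rewrite exp_0, Rmult_1_r in H1; rewrite sin_0, Rmult_1_r, Rminus_0_r in H2.
  rewrite cos_0, Rmult_0_r, Rminus_0_r in H3.
  set (r := Cmod (x, y)) in *.
  assert (Hx0 := Rabs_pos x); assert (Hy0 := Rabs_pos y).
  replace (cexp (x, y) - 1 - (x, y))%C
    with ((exp x - 1 - x) * cos y + (1 + x) * (cos y - 1),
          exp x * (sin y - y) + (exp x - 1 - x + x) * y)
    by (apply injective_projections; unfold cexp; simpl; ring).
  apply Rle_trans with (1 := Cmod_le_split _ _).
  assert (Hre : Rabs ((exp x - 1 - x) * cos y + (1 + x) * (cos y - 1))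
    <= e * r + 2 * (e * r)).
  { apply Rle_trans with (1 := Rabs_triang _ _); rewrite !Rabs_mult.
    apply Rplus_le_compat.
    - rewrite <- (Rmult_1_r (e * r)).
      apply Rmult_le_compat; try apply Rabs_pos; [nra |].
      apply Rabs_le, COS_bound.
    - apply Rmult_le_compat; try apply Rabs_pos; [| nra].
      apply Rle_trans with (1 := Rabs_triang _ _); rewrite Rabs_R1; lra. }
  assert (Hlin : Rabs (exp x - 1 - x + x) <= 2 * e).
  { apply Rle_trans with (1 := Rabs_triang _ _); nra. }
  assert (Him : Rabs (exp x * (sin y - y) + (exp x - 1 - x + x) * y)
    <= 3 * (e * r) + 2 * e * r).
  { apply Rle_trans with (1 := Rabs_triang _ _); rewrite !Rabs_mult.
    apply Rplus_le_compat.
    - apply Rmult_le_compat; try apply Rabs_pos; [| nra].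
      rewrite Rabs_pos_eq by apply Rlt_le, exp_pos.
      replace (exp x - 1 - x + x) with (exp x - 1) in Hlin by ring.
      apply Rabs_le_between in Hlin; lra.
    - apply Rmult_le_compat; try apply Rabs_pos; assumption. }
  assert (0 <= r) by apply Cmod_ge_0.
  nra. }
exists (cexp w); apply is_derive_C_eps; intros eps Heps.
assert (Hw : 0 < Cmod (cexp w)) by (rewrite Cmod_cexp; apply exp_pos).
destruct (H0 (eps / Cmod (cexp w)) (Rdiv_lt_0_compat _ _ Heps Hw)) as [d [Hd0 Hd]].
exists d; split; [exact Hd0 |]; intros v Hv.
replace (cexp v) with (cexp w * cexp (v - w))%C
  by (rewrite <- cexp_plus; f_equal; ring).
replace (cexp w * cexp (v - w) - cexp w - (v - w) * cexp w)%C
  with (cexp w * (cexp (v - w) - 1 - (v - w)))%C by ring.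
rewrite Cmod_mult.
apply Rle_trans with (1 := Rmult_le_compat_l _ _ _ (Rlt_le _ _ Hw) (Hd _ Hv)).
right; field; lra.
Qed.

(** Goursat's theorem for [h o cexp] on [[a, b] x [0, 2 PI]]: the horizontal
    sides cancel by periodicity, which leaves the two circles of radii [exp a] and
    [exp b]. *)
Lemma circle_integral_constant (h : C -> C) (a b : R) :
  (forall z, Cmod z < 1 -> ex_derive h z) -> a <= b < 0 ->
  CInt (fun t => h (cexp (a, t))) 0 (2 * PI) = CInt (fun t => h (cexp (b, t))) 0 (2 * PI).
Proof.
intros Hh Hab.
assert (HPI := PI_RGT_0).
assert (H : rectangle_integral (fun w => h (cexp w)) a b 0 (2 * PI) = RtoC 0).
{ apply rectangle_integral_zero; [lra | lra |].
  intros x y Hx Hy; apply ex_derive_C_comp; [| apply ex_derive_cexp].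
  apply Hh; rewrite Cmod_cexp, <- exp_0; apply exp_increasing; simpl; lra. }
unfold rectangle_integral in H.
assert (Hper : CInt (fun x => h (cexp (x, 2 * PI))) a b = CInt (fun x => h (cexp (x, 0))) a b).
{ apply (@RInt_ext C_R_CompleteNormedModule); intros x _.
  unfold cexp; simpl; now rewrite cos_2PI, sin_2PI, cos_0, sin_0. }
rewrite Hper in H.
set (I := CInt (fun x => h (cexp (x, 0))) a b) in H.
set (A := CInt (fun t => h (cexp (a, t))) 0 (2 * PI)) in *.
set (B := CInt (fun t => h (cexp (b, t))) 0 (2 * PI)) in *.
(* [H] says that [Ci * (B - A) = 0]. *)
replace B with (A + - Ci * (I + Ci * B - I - Ci * A))%C
  by (apply injective_projections; simpl; ring).
rewrite H; ring.
Qed.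

(** [2 PI h(0)] is the limit of the circle integrals as the radius tends to 0.
    Since these do not depend on the radius, the bound on the circle of radius [r]
    applies to it. *)
Lemma Cmod_center_le (h : C -> C) (r M : R) :
  (forall z, Cmod z < 1 -> ex_derive h z) -> 0 < r < 1 ->
  (forall z, Cmod z = r -> Cmod (h z) <= M) ->
  Cmod (h (RtoC 0)) <= M.
Proof.
intros Hh Hr HM; apply le_epsilon; intros eps Heps.
destruct (ex_derive_C_continuous_eps h (RtoC 0)) with (eps := eps) as [d [Hd0 Hd]];
  [apply Hh; rewrite Cmod_0; lra | exact Heps |].
(* A radius so small that [h] differs from [h 0] by less than [eps] on its circle. *)
set (s := Rmin r (d / 2)).
assert (Hs0 : 0 < s) by (apply Rmin_pos; lra).
assert (Hsr : s <= r) by apply Rmin_l; assert (Hsd : s <= d / 2) by apply Rmin_r.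
assert (HPI := PI_RGT_0).
assert (Hint : forall x, x < 0 -> is_CInt (fun t => h (cexp (x, t))) 0 (2 * PI)
  (CInt (fun t => h (cexp (x, t))) 0 (2 * PI))).
{ intros x Hx; apply (is_CInt_vertical (fun w => h (cexp w))); [| lra].
  intros y Hy; apply ex_derive_C_comp; [| apply ex_derive_cexp].
  apply Hh; rewrite Cmod_cexp, <- exp_0; apply exp_increasing; exact Hx. }
assert (Hlnr : ln r < 0) by (rewrite <- ln_1; apply ln_increasing; lra).
assert (Hlns : ln s <= ln r).
{ destruct Hsr as [H| ->]; [left; now apply ln_increasing | lra]. }
assert (Hfar := is_CInt_close _ _ 0 (2 * PI) M _ _ ltac:(lra) (Hint (ln r) Hlnr)
  (is_RInt_const 0 (2 * PI) (RtoC 0 : C_R_NormedModule))).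
assert (Hnear := is_CInt_close _ _ 0 (2 * PI) eps _ _ ltac:(lra) (Hint (ln s) ltac:(lra))
  (is_RInt_const 0 (2 * PI) (h (RtoC 0) : C_R_NormedModule))).
rewrite scal_R_Cmult in Hfar, Hnear.
rewrite (circle_integral_constant h (ln s) (ln r)) in Hnear by (try assumption; lra).
set (I := CInt (fun t => h (cexp (ln r, t))) 0 (2 * PI)) in *.
assert (H1 : Cmod (I - RtoC (2 * PI - 0) * 0)%C <= (2 * PI - 0) * M).
{ apply Hfar; intros t _.
  replace (h (cexp (ln r, t)) - RtoC 0)%C with (h (cexp (ln r, t))) by ring.
  apply HM; rewrite Cmod_cexp; apply exp_ln; lra. }
assert (H2 : Cmod (I - RtoC (2 * PI - 0) * h (RtoC 0))%C <= (2 * PI - 0) * eps).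
{ apply Hnear; intros t _.
  apply Rlt_le, Hd.
  replace (cexp (ln s, t) - RtoC 0)%C with (cexp (ln s, t)) by ring.
  rewrite Cmod_cexp; simpl; rewrite exp_ln; lra. }
rewrite Rminus_0_r in H1, H2.
replace (I - RtoC (2 * PI) * 0)%C with I in H1 by ring.
assert (H3 : 2 * PI * Cmod (h (RtoC 0)) <= 2 * PI * (M + eps)).
{ rewrite <- (Rabs_pos_eq (2 * PI)) at 1 by lra.
  rewrite <- Cmod_R, <- Cmod_mult.
  replace (RtoC (2 * PI) * h (RtoC 0))%C
    with (I + - (I - RtoC (2 * PI) * h (RtoC 0)))%C by ring.
  apply Rle_trans with (1 := Cmod_triangle _ _); rewrite Cmod_opp; lra. }
apply Rmult_le_reg_l with (2 := H3); lra.
Qed.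

(** * Moebius transformations and the maximum modulus principle *)

Definition mobius (a z : C) : C := ((z - a) / (1 - Cconj a * z))%C.

Lemma mobius_denominator (a z : C) :
  Cmod a < 1 -> Cmod z <= 1 -> 1 - Cmod a <= Cmod (1 - Cconj a * z)%C.
Proof.
intros Ha Hz.
assert (H := Cmod_triangle (1 - Cconj a * z) (Cconj a * z)).
replace (1 - Cconj a * z + Cconj a * z)%C with (RtoC 1) in H by ring.
rewrite Cmod_1, Cmod_mult, Cmod_conj in H.
assert (H1 := Cmod_ge_0 a); nra.
Qed.

Lemma mobius_denominator_neq_0 (a z : C) :
  Cmod a < 1 -> Cmod z <= 1 -> (1 - Cconj a * z)%C <> 0%C.
Proof.
intros Ha Hz; apply Cmod_gt_0.
assert (H := mobius_denominator a z Ha Hz); lra.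
Qed.

Lemma ex_derive_mobius (a z : C) :
  Cmod a < 1 -> Cmod z <= 1 -> ex_derive (mobius a) z.
Proof.
intros Ha Hz.
apply (ex_derive_ext (fun w => (- a + 1 * w) * / (1 + - Cconj a * w))%C).
{ intros w; unfold mobius, Cdiv; f_equal; [| f_equal]; ring. }
apply ex_derive_C_mult; [apply ex_derive_C_affine |].
apply (ex_derive_C_comp Cinv); [| apply ex_derive_C_affine].
apply ex_derive_Cinv.
replace (1 + - Cconj a * z)%C with (1 - Cconj a * z)%C by ring.
now apply mobius_denominator_neq_0.
Qed.

(** The difference of the squared moduli of denominator and numerator: it
    governs how far the modulus of [mobius a z] is from 1. *)
Lemma mobius_modulus_identity (a z : C) :
  Cmod (1 - Cconj a * z)%C ^ 2 - Cmod (z - a)%C ^ 2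
  = (1 - Cmod a ^ 2) * (1 - Cmod z ^ 2).
Proof. rewrite !Cmod2_alt; destruct a, z; simpl; ring. Qed.

Lemma Cmod_mobius_lt_1 (a z : C) :
  Cmod a < 1 -> Cmod z < 1 -> Cmod (mobius a z) < 1.
Proof.
intros Ha Hz.
assert (Hd := mobius_denominator a z Ha (Rlt_le _ _ Hz)).
unfold mobius; rewrite Cmod_div by (apply mobius_denominator_neq_0; lra).
apply Rlt_div_l; [lra |].
assert (H := mobius_modulus_identity a z).
assert (Ha0 := Cmod_ge_0 a); assert (Hz0 := Cmod_ge_0 z).
assert (0 < (1 - Cmod a ^ 2) * (1 - Cmod z ^ 2)) by (apply Rmult_lt_0_compat; nra).
assert (Hn := Cmod_ge_0 (z - a)); nra.
Qed.

(** The explicit width of the annulus comes from [mobius_modulus_identity]: the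
    right-hand side is at most [4 (1 - |a|) (1 - |z|)], while the squared
    denominator is at least [(1 - |a|) ^ 2]. *)
Lemma Cmod_mobius_ge (a z : C) (q : R) :
  Cmod a < 1 -> 0 <= q <= 1 ->
  1 - (1 - q) * (1 - Cmod a) / 4 <= Cmod z <= 1 -> q <= Cmod (mobius a z).
Proof.
intros Ha Hq [Hz1 Hz].
assert (Hd := mobius_denominator a z Ha Hz).
unfold mobius; rewrite Cmod_div by (apply mobius_denominator_neq_0; lra).
apply Rle_div_r; [lra |].
assert (H := mobius_modulus_identity a z).
assert (Ha0 := Cmod_ge_0 a); assert (Hz0 := Cmod_ge_0 z).
assert (Hn := Cmod_ge_0 (z - a)).
set (A := Cmod a) in *; set (Z := Cmod z) in *.
set (N := Cmod (z - a)%C) in *; set (D := Cmod (1 - Cconj a * z)%C) in *.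
assert (H1 : (1 - A ^ 2) * (1 - Z ^ 2) <= 2 * (1 - A) * (2 * (1 - Z)))
  by (apply Rmult_le_compat; nra).
assert (H2 : 2 * (1 - A) * (2 * (1 - Z)) <= (1 - q) * (1 - A) ^ 2) by nra.
assert (H3 : (1 - q) * (1 - A) ^ 2 <= (1 - q ^ 2) * D ^ 2)
  by (apply Rmult_le_compat; nra).
apply Rsqr_incr_0_var; [unfold Rsqr; nra | exact Hn].
Qed.

(** Since [mobius (- a)] sends 0 to [a], the value at [a] is the value at the
    centre of [f o mobius (- a)], which is still differentiable in the disk.  On a
    circle close enough to the unit circle, [mobius (- a)] takes its values in the
    annulus where the bound on [f] is known. *)
Lemma maximum_modulus (f : C -> C) (r M : R) :
  (forall z, Cmod z < 1 -> ex_derive f z) -> r < 1 ->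
  (forall z, r <= Cmod z < 1 -> Cmod (f z) <= M) ->
  forall a, Cmod a < 1 -> Cmod (f a) <= M.
Proof.
intros Hf Hr HM a Ha.
assert (Ha0 := Cmod_ge_0 a).
assert (Ha' : Cmod (- a)%C < 1) by now rewrite Cmod_opp.
(* [Cmod_mobius_ge] needs a nonnegative lower bound. *)
set (q := Rmax r 0).
assert (Hq : r <= q /\ 0 <= q < 1)
  by (split; [apply Rmax_l | split; [apply Rmax_r | apply Rmax_lub_lt; lra]]).
clearbody q.
replace a with (mobius (- a) (RtoC 0))
  by (unfold mobius; apply injective_projections; simpl; field; lra).
apply (Cmod_center_le (fun z => f (mobius (- a) z))
  (1 - (1 - q) * (1 - Cmod (- a)%C) / 4)).
- intros z Hz; apply ex_derive_C_comp; [| now apply ex_derive_mobius, Rlt_le].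
  now apply Hf, Cmod_mobius_lt_1.
- rewrite Cmod_opp; nra.
- intros z Hz; apply HM.
  assert (Cmod z < 1) by (rewrite Hz, Cmod_opp; nra).
  split; [| now apply Cmod_mobius_lt_1].
  apply Rle_trans with q; [apply Hq |].
  apply Cmod_mobius_ge; lra.
Qed.

(** * Blaschke products *)

(** The extension by 0 agrees with [f] on the closed disk, and near each interior
    point; on the boundary only the continuity within the closed disk matters. *)
Lemma in_disk_algebra_of_ex_derive (f : C -> C) :
  (forall z, Cmod z <= 1 -> ex_derive f z) ->
  in_disk_algebra (fun z => f (proj1_sig z)).
Proof.
intros Hf; split.
- intros z Hz; apply filterlim_locally; intros eps.
  destruct (ex_derive_C_continuous_eps f z (Hf z Hz) eps (cond_pos eps)) as [d [Hd0 Hd]].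
  apply locally_C; exists (mkposreal d Hd0); intros w Hw Hw1.
  rewrite (extend_in _ z Hz), (extend_in _ w Hw1).
  apply C_NormedModule_mixin_compat1, Hd, Hw.
- intros z Hz.
  apply (ex_derive_ext_loc f); [| apply Hf; lra].
  assert (He : 0 < 1 - Cmod z) by lra.
  exists (mkposreal _ He); intros w Hw.
  change (Cmod (w - z) < 1 - Cmod z) in Hw.
  assert (H := Cmod_triangle (w - z) z).
  assert (Hwz : (w - z + z)%C = w) by ring; rewrite Hwz in H.
  now rewrite (extend_in _ w ltac:(lra)).
Qed.

Lemma blaschke_cons (gamma a : C) (zs : list C) (z : C) :
  blaschke gamma (a :: zs) z = (mobius a z * blaschke gamma zs z)%C.
Proof. unfold blaschke, mobius; simpl; ring. Qed.

Lemma ex_derive_blaschke (gamma : C) (zs : list C) (z : C) :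
  (forall a, In a zs -> Cmod a < 1) -> Cmod z <= 1 -> ex_derive (blaschke gamma zs) z.
Proof.
intros Hzs Hz; induction zs as [|a zs IH].
- exact (@ex_derive_const C_AbsRing C_NormedModule (gamma * 1)%C z).
- apply (ex_derive_ext (fun w => mobius a w * blaschke gamma zs w)%C).
  { intros w; symmetry; apply blaschke_cons. }
  apply ex_derive_C_mult.
  + apply ex_derive_mobius; [apply Hzs; now left | exact Hz].
  + apply IH; intros b Hb; apply Hzs; now right.
Qed.

Lemma blaschke_zero (gamma a : C) (zs : list C) :
  In a zs -> blaschke gamma zs a = 0%C.
Proof.
induction zs as [|b zs IH]; [easy |]; rewrite blaschke_cons; intros [-> | H].
- unfold mobius, Cdiv; ring.
- rewrite IH by exact H; ring.
Qed.

(** By induction on the number of factors.  To make the product of two factors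
    at least [q], both are made at least [(1 + q) / 2], whose square exceeds [q]
    by [((1 - q) / 2) ^ 2]. *)
Lemma Cmod_blaschke_near_circle (gamma : C) (zs : list C) (q : R) :
  (forall a, In a zs -> Cmod a < 1) -> Cmod gamma = 1 -> 0 <= q < 1 ->
  exists r, r < 1 /\ forall z, r <= Cmod z <= 1 -> q <= Cmod (blaschke gamma zs z).
Proof.
intros Hzs Hgamma; revert q; induction zs as [|a zs IH]; intros q Hq.
- exists 0; split; [lra |]; intros z _.
  unfold blaschke; simpl; rewrite Cmult_1_r; lra.
- destruct (IH (fun b Hb => Hzs b (or_intror Hb)) ((1 + q) / 2)) as [r [Hr Hrz]]; [lra |].
  assert (Ha := Hzs a (or_introl eq_refl)).
  exists (Rmax r (1 - (1 - (1 + q) / 2) * (1 - Cmod a) / 4)); split.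
  { apply Rmax_lub_lt; nra. }
  intros z [Hz1 Hz].
  assert (H1 := Hrz z (conj (Rle_trans _ _ _ (Rmax_l _ _) Hz1) Hz)).
  assert (H2 : (1 + q) / 2 <= Cmod (mobius a z)).
  { apply Cmod_mobius_ge; [exact Ha | lra |].
    split; [exact (Rle_trans _ _ _ (Rmax_r _ _) Hz1) | exact Hz]. }
  rewrite blaschke_cons, Cmod_mult.
  apply Rle_trans with ((1 + q) / 2 * ((1 + q) / 2)); [nra |].
  apply Rmult_le_compat; lra.
Qed.

(** For each [q < 1], [|f|] is at most [N / q] on an annulus where the Blaschke
    product is at least [q] in modulus, [N] being the norm of the product.  The
    maximum modulus principle extends this to the disk, and [q] tends to 1. *)
Lemma sup_norm_blaschke_mult_ge (gamma : C) (zs : list C) (f : closed_disk -> C) :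
  (forall a, In a zs -> Cmod a < 1) -> Cmod gamma = 1 -> in_disk_algebra f ->
  sup_norm f <= sup_norm (fun z => blaschke gamma zs (proj1_sig z) * f z)%C.
Proof.
intros Hzs Hgamma Hf.
set (N := sup_norm (fun z => blaschke gamma zs (proj1_sig z) * f z)%C).
assert (HB := in_disk_algebra_of_ex_derive _ (fun z => ex_derive_blaschke gamma zs z Hzs)).
assert (HN : forall z : closed_disk, Cmod (blaschke gamma zs (proj1_sig z)) * Cmod (f z) <= N).
{ intros z; rewrite <- Cmod_mult.
  exact (sup_norm_ge _ z (in_disk_algebra_mult _ _ HB Hf)). }
assert (Hq : forall q, 0 < q < 1 -> forall z, q * Cmod (f z) <= N).
{ intros q Hq.
  destruct (Cmod_blaschke_near_circle gamma zs q Hzs Hgamma) as [r [Hr Hrz]]; [lra |].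
  assert (Hring : forall z : closed_disk, r <= Cmod (proj1_sig z) -> q * Cmod (f z) <= N).
  { intros z Hz; apply Rle_trans with (2 := HN z).
    apply Rmult_le_compat_r; [apply Cmod_ge_0 |].
    apply Hrz; split; [exact Hz | apply proj2_sig]. }
  intros [z Hz].
  destruct (Rle_lt_dec r (Cmod z)) as [Hrle|Hrlt]; [now apply Hring |].
  rewrite <- (extend_in f z Hz), Rmult_comm.
  apply Rle_div_r; [lra |].
  apply maximum_modulus with (r := r); [apply Hf | exact Hr | | lra].
  intros w [Hw1 Hw].
  apply Rle_div_r; [lra |].
  rewrite (extend_in f w (Rlt_le _ _ Hw)), Rmult_comm.
  now apply Hring. }
apply sup_norm_le; intros z.
assert (Hhalf := Hq (1 / 2) ltac:(lra) z).
assert (Hf0 := Cmod_ge_0 (f z)).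
apply Rnot_lt_le; intros Hlt.
(* With this [q], [q * Cmod (f z)] is the midpoint of [N] and [Cmod (f z)], so
   it exceeds [N]. *)
assert (H := Hq ((1 + N / Cmod (f z)) / 2)).
assert (Hratio : 0 <= N / Cmod (f z) < 1).
{ split; [apply Rdiv_le_0_compat; lra | apply Rlt_div_l; lra]. }
specialize (H ltac:(lra) z).
replace ((1 + N / Cmod (f z)) / 2 * Cmod (f z)) with ((Cmod (f z) + N) / 2) in H
  by (field; lra).
lra.
Qed.

Theorem lemma7 (gamma : C) (zs : list C)
    (hn : (1 <= length zs)%nat)
    (hzs : forall a : C, In a zs -> Cmod a < 1)
    (hgamma : Cmod gamma = 1) :
  exists hB : in_disk_algebra (fun z : closed_disk => blaschke gamma zs (proj1_sig z)),
    let B : disk_algebra := exist in_disk_algebra _ hB in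
    singular B /\ ~ topological_divisor_of_zero B.
Proof.
exists (in_disk_algebra_of_ex_derive _ (fun z => ex_derive_blaschke gamma zs z hzs)).
intros B; split.
- intros [y [Hy _]].
  destruct zs as [|a zs]; [simpl in hn; lia |].
  assert (Ha := hzs a (or_introl eq_refl)).
  assert (H := f_equal (fun g : disk_algebra =>
    proj1_sig g (exist _ a (Rlt_le _ _ Ha))) Hy).
  simpl in H; rewrite blaschke_zero, Cmult_0_l in H by now left.
  now apply C1_nz.
- intros [u [Hu Hlim]].
  (* The disk algebra is commutative, so the side of the multiplication is
     immaterial. *)
  assert (Hcomm : forall f g : disk_algebra, mult f g = mult g f).
  { intros f g; apply da_ext; intros z; simpl; ring. }
  assert (H : filterlim (fun n => mult B (u n)) eventually (locally (zero : da_AbsRing))).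
  { destruct Hlim as [H|H]; [exact H |].
    apply filterlim_ext with (2 := H); intros n; apply Hcomm. }
  destruct (proj1 (filterlim_locally (U := AbsRing_UniformSpace da_AbsRing) _ _) H
    (mkposreal 1 Rlt_0_1)) as [n Hn].
  specialize (Hn n (le_n n)).
  change (abs (minus (mult B (u n)) zero) < 1) in Hn.
  rewrite minus_zero_r in Hn.
  assert (Hge := sup_norm_blaschke_mult_ge gamma zs (proj1_sig (u n)) hzs hgamma
    (proj2_sig (u n))).
  change (abs (u n) <= abs (mult B (u n))) in Hge.
  rewrite Hu in Hge; lra.
Qed.
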